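(* Let $\mathbf L$ be an $\mathrm e$-cyclic residuated lattice that satisfies the left prelinearity law $((x\backslash y)\wedge \mathrm e)\vee((y\backslash x)\wedge \mathrm e)\approx \mathrm e$. Then for every convex subalgebra $H$ of $\mathbf L$ the following are equivalent: (1) $H$ is a prime convex subalgebra of $\mathbf L$. (2) For all $a,b\in L$, if $|a|\vee|b|\in H$, then $a\in H$ or $b\in H$. (3) For all $a,b\in L$, if $|a|\vee|b|=\mathrm e$, then $a\in H$ or $b\in H$. (4) For all $a,b\in L$, $(a\backslash b)\wedge \mathrm e\in H$ or $(b\backslash a)\wedge \mathrm e\in H$. (5) The set of all convex subalgebras of $\mathbf L$ containing $H$ is a chain under set-inclusion.
   Context: A residuated lattice is an algebra $\mathbf L=(L,\cdot,\backslash,/,\vee,\wedge,\mathrm e)$ such that $(L,\cdot,\mathrm e)$ is a monoid, $(L,\vee,\wedge)$ is a lattice with order $\le$, and $x\cdot y\le z \iff y\le x\backslash z \iff x\le z/y$ for all $x,y,z\in L$. It is $\mathrm e$-cyclic if $\mathrm e/x=x\backslash \mathrm e$ for all $x\in L$. The absolute value of $x\in L$ is $|x|=x\wedge(\mathrm e/x)\wedge \mathrm e$. A convex subalgebra of $\mathbf L$ is a subalgebra (closed under all operations, containing $\mathrm e$) whose universe is order-convex. $\mathcal C(\mathbf L)$ is the lattice of convex subalgebras ordered by inclusion (meets are intersections). $H\in\mathcal C(\mathbf L)$ is prime if it is meet-irreducible in $\mathcal C(\mathbf L)$, i.e. whenever $X,Y\in\mathcal C(\mathbf L)$ and $X\cap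 Y\subseteq H$, then $X\subseteq H$ or $Y\subseteq H$. *)

(* Defs.v *)
From HB Require Import structures.
From mathcomp Require Import all_boot all_order.
From mathcomp Require Import boolp classical_sets.

Set Implicit Arguments.
Unset Strict Implicit.
Unset Printing Implicit Defensive.

Import Order.Theory.

Local Open Scope classical_set_scope.
Local Open Scope group_scope.
Local Open Scope order_scope.

(* [ldiv x z] stands for x \ z and [rdiv z y] for z / y. *)
HB.mixin Record Lattice_Monoid_isResiduated (d : Order.disp_t) (L : Type)
    of Order.Lattice d L & monoid.Monoid L := {
  ldiv : L -> L -> L;
  rdiv : L -> L -> L;
  ldivP : forall x y z : L, (x * y <= z) = (y <= ldiv x z);
  rdivP : forall x y z : L, (x * y <= z) = (x <= rdiv z y)
}.

#[short(type="residuatedLatticeType")]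
HB.structure Definition ResiduatedLattice (d : Order.disp_t) :=
  { L of Lattice_Monoid_isResiduated d L
       & Order.Lattice d L & monoid.Monoid L }.

Section ResiduatedLatticeDefs.
Context {d : Order.disp_t} (L : residuatedLatticeType d).
Implicit Types (x y z : L) (H : set L).

Definition e_cyclic : Prop := forall x, rdiv 1 x = ldiv x 1.

Definition left_prelinear : Prop :=
  forall x y, (ldiv x y `&` 1) `|` (ldiv y x `&` 1) = 1 :> L.

Definition rl_abs x : L := x `&` rdiv 1 x `&` 1.

Record is_convex_subalgebra H : Prop := IsConvexSubalgebra {
  convsub_one : H 1;
  convsub_mul : forall x y, H x -> H y -> H (x * y);
  convsub_ldiv : forall x y, H x -> H y -> H (ldiv x y);
  convsub_rdiv : forall x y, H x -> H y -> H (rdiv x y);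
  convsub_join : forall x y, H x -> H y -> H (x `|` y);
  convsub_meet : forall x y, H x -> H y -> H (x `&` y);
  convsub_convex : forall x y z, H x -> H z -> x <= y <= z -> H y
}.

Definition convex_subalgebras : set (set L) := [set H | is_convex_subalgebra H].

(* Properness is not required: the whole algebra is prime. *)
Definition prime_convex_subalgebra H : Prop :=
  convex_subalgebras H /\
  forall X Y, convex_subalgebras X -> convex_subalgebras Y ->
    (X `&` Y)%classic `<=` H -> X `<=` H \/ Y `<=` H.

End ResiduatedLatticeDefs.

Arguments convex_subalgebras {d} L.

(* Main.v *)
(** (5) implies (1): if [X `&` Y] is contained in [H] but neither [X] nor [Y]
    is, pick negative [x] in [X] and [y] in [Y] outside [H]; then [x `|` y] is
    in [X `&` Y], hence in [H]. The convex subalgebras generated by [H] with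
    [x] and by [H] with [y] are comparable, so that, say, [y] lies above a
    product [w] of [x] and negative elements of [H]. Since
    [(y `|` s) * (y `|` t) <= y `|` s * t] for negative elements,
    [y = y `|` w] lies above a product of elements of [H], a contradiction.
    The same inequality gives (1) implies (2), with the convex subalgebras
    generated by [a] and by [b]. For (3) implies (4), prelinearity is the
    hypothesis of (3) for the negative elements [ldiv a b `&` 1] and
    [ldiv b a `&` 1]. For (4) implies (5), if [h = ldiv a b `&` 1] is in [H]
    and [b] is negative, then [a * h <= b <= 1] puts [b] in every convex
    subalgebra containing [H] and [a]. *)
Require Import Defs.
From HB Require Import structures.
From mathcomp Require Import all_boot all_order.
From mathcomp Require Import boolp classical_sets.

Set Implicit Arguments.
Unset Strict Implicit.
Unset Printing Implicit Defensive.

Import Order.Theory.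

Local Open Scope classical_set_scope.
Local Open Scope group_scope.
Local Open Scope order_scope.

Section ResiduatedLatticeTheory.
Context {d : Order.disp_t} {L : residuatedLatticeType d}.
Implicit Types (x y z a b c s t : L) (H K M S : set L).

(** * Residuation and multiplication by negative elements *)

Lemma rl_lemulr x y z : y <= z -> x * y <= x * z.
Proof. by move=> le_yz; rewrite ldivP (le_trans le_yz)// -ldivP. Qed.

Lemma rl_lemull x y z : y <= z -> y * x <= z * x.
Proof. by move=> le_yz; rewrite rdivP (le_trans le_yz)// -rdivP. Qed.

Lemma rl_lemul x y z t : x <= y -> z <= t -> x * z <= y * t.
Proof.
by move=> xy zt; apply: le_trans (rl_lemull _ xy) (rl_lemulr _ zt).
Qed.

Lemma rl_mul_ldiv_le x y : x * ldiv x y <= y.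
Proof. by rewrite ldivP. Qed.

Lemma rl_rdiv_mul_le x y : rdiv y x * x <= y.
Proof. by rewrite rdivP. Qed.

Lemma rl_mul_negl x y : x <= 1 -> x * y <= y.
Proof. by move=> x1; rewrite -{2}(mul1g y) rl_lemull. Qed.

Lemma rl_mul_negr x y : y <= 1 -> x * y <= x.
Proof. by move=> y1; rewrite -{2}(mulg1 x) rl_lemulr. Qed.

Lemma rl_mul_le1 x y : x <= 1 -> y <= 1 -> x * y <= 1.
Proof. by move=> x1 y1; apply: le_trans y1; apply: rl_mul_negl. Qed.

(** By residuation the product distributes over both joins; every term except [s * t] is [c] times a
    negative element, on one side or the other, hence below [c]. *)
Lemma rl_join_mul_le c s t : c <= 1 -> s <= 1 -> t <= 1 ->
  (c `|` s) * (c `|` t) <= c `|` s * t.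
Proof.
move=> c1 s1 t1; rewrite rdivP leUx -!rdivP; apply/andP; split.
  by apply: le_trans (leUl _ _); apply: rl_mul_negr; rewrite leUx c1.
rewrite ldivP leUx -!ldivP leUr andbT.
by apply: le_trans (leUl _ _); apply: rl_mul_negl.
Qed.

(** * Absolute values and membership in convex subalgebras *)

Lemma rl_abs_le1 x : rl_abs x <= 1.
Proof. exact: leIr. Qed.

Lemma rl_abs_le x : rl_abs x <= x.
Proof. by rewrite /rl_abs -meetA leIl. Qed.

Lemma rl_abs_mul_le1 x : rl_abs x * x <= 1.
Proof. by rewrite rdivP /rl_abs meetAC leIr. Qed.

Lemma rl_abs_neg x : x <= 1 -> rl_abs x = x.
Proof.
move=> x1; have x1x : x <= rdiv 1 x by rewrite -rdivP rl_mul_le1.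
by rewrite /rl_abs (meet_l x1x) (meet_l x1).
Qed.

(** Convexity recovers [x], which lies between [rl_abs x] and [ldiv (rl_abs x) 1]. Membership
    questions thus reduce to negative elements. *)
Lemma convsub_abs H x : is_convex_subalgebra H -> H (rl_abs x) <-> H x.
Proof.
move=> [H1 _ Hl Hr _ Hm Hc]; split=> [Hx|Hx]; last first.
  by apply: (Hm) => //; apply: (Hm) => //; apply: Hr.
apply: (Hc _ _ _ Hx (Hl _ _ Hx H1)).
by rewrite rl_abs_le -ldivP rl_abs_mul_le1.
Qed.

Lemma convsub_up H x y : is_convex_subalgebra H -> H x -> x <= y -> y <= 1 -> H y.
Proof.
by move=> cH Hx xy y1; apply: (convsub_convex cH Hx (convsub_one cH)); rewrite xy.
Qed.

Lemma not_subset_convsub_neg H K : is_convex_subalgebra H ->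
  is_convex_subalgebra K -> ~ K `<=` H -> exists x, [/\ x <= 1, K x & ~ H x].
Proof.
move=> cH cK /existsNP[x /not_implyP[Kx nHx]]; exists (rl_abs x).
split; [exact: rl_abs_le1 | exact/convsub_abs | ].
by move/(convsub_abs _ cH).
Qed.

(** * Generated convex subalgebras *)

Inductive monoid_closure S : set L :=
| MonoidClosure1 : monoid_closure S 1
| MonoidClosureGen x : S x -> monoid_closure S x
| MonoidClosureM x y :
    monoid_closure S x -> monoid_closure S y -> monoid_closure S (x * y).

Lemma monoid_closure_le1 S : (forall x, S x -> x <= 1) ->
  forall x, monoid_closure S x -> x <= 1.
Proof.
by move=> S1 x; elim=> {x}// x y _ x1 _ y1; apply: rl_mul_le1.
Qed.

(** Induction on [s]: for a product, [(c]|[s) * (c]|[t)] is in [H] and below the negative element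
    [c]|[s * t], so convexity applies. *)
Lemma convsub_join_monoid_closure H S c : is_convex_subalgebra H ->
  c <= 1 -> (forall x, S x -> x <= 1) -> (forall x, S x -> H (c `|` x)) ->
  forall s, monoid_closure S s -> H (c `|` s).
Proof.
move=> cH c1 S1 HS s; elim=> {s}[|x /HS//|s t Ms Hs Mt Ht].
  by rewrite (join_r c1); apply: convsub_one.
have [s1 t1] := (monoid_closure_le1 S1 Ms, monoid_closure_le1 S1 Mt).
apply: (convsub_up cH (convsub_mul cH Hs Ht)); first exact: rl_join_mul_le.
by rewrite leUx c1 rl_mul_le1.
Qed.

(* For negative generators of an e-cyclic algebra, this is the generated convex
   subalgebra. *)
Definition convsub_gen S : set L :=
  [set z | exists2 s, monoid_closure S s & s <= z <= ldiv s 1].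

Lemma sub_convsub_gen S x : x <= 1 -> S x -> convsub_gen S x.
Proof.
move=> x1 Sx; exists x; first exact: MonoidClosureGen.
by rewrite lexx -ldivP rl_mul_le1.
Qed.

Lemma convsub_gen_convex_subalgebra S : e_cyclic L ->
  (forall x, S x -> x <= 1) -> is_convex_subalgebra (convsub_gen S).
Proof.
move=> cyc S1.
(* E-cyclicity lets the factors of a product below [1] be swapped, so each bounding [s] can cancel
   [z] from either side. *)
have cycE x y : (x * y <= 1) = (y * x <= 1) by rewrite ldivP rdivP cyc.
have genE z : convsub_gen S z ->
    exists s, [/\ monoid_closure S s, s <= 1, s <= z, s * z <= 1 & z * s <= 1].
  case=> s Ms /andP[sz zs]; exists s; split=> //.
  - exact: monoid_closure_le1 Ms.
  - by rewrite ldivP.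
  - by rewrite cycE ldivP.
(* The two bounds on [z] may come from different elements: the product [s * t] serves for both. *)
have intro z s t : monoid_closure S s -> monoid_closure S t ->
    s <= z -> t * z <= 1 -> convsub_gen S z.
  move=> Ms Mt sz tz; have s1 := monoid_closure_le1 S1 Ms.
  have t1 := monoid_closure_le1 S1 Mt.
  exists (s * t); first exact: MonoidClosureM.
  by rewrite (le_trans (rl_mul_negr _ t1))//= -ldivP -mulgA rl_mul_le1.
split.
- by apply: (intro _ 1 1); rewrite ?mulg1//; apply: MonoidClosure1.
- move=> x y /genE[s [Ms s1 sx s_x _]] /genE[t [Mt t1 ty t_y _]].
  apply: (intro _ (s * t) (t * s)); try exact: MonoidClosureM.
    exact: rl_lemul.
  rewrite -mulgA (mulgA s) (le_trans _ t_y)//.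
  by apply: rl_lemulr; apply: rl_mul_negl.
- move=> x y /genE[s [Ms s1 sx _ x_s]] /genE[t [Mt t1 ty t_y _]].
  (* Here [x * s * t <= t <= y] and [t * s * ldiv x y <= t * x * ldiv x y <= t * y <= 1]. *)
  apply: (intro _ (s * t) (t * s)); try exact: MonoidClosureM.
    by rewrite -ldivP mulgA (le_trans _ ty)// rl_mul_negl.
  rewrite -mulgA (le_trans _ t_y)//; apply: rl_lemulr.
  exact: le_trans (rl_lemull _ sx) (rl_mul_ldiv_le _ _).
- move=> x y /genE[s [Ms s1 sx _ x_s]] /genE[t [Mt t1 ty t_y _]].
  apply: (intro _ (s * t) (t * s)); try exact: MonoidClosureM.
    by rewrite -rdivP -mulgA (le_trans _ sx)// rl_mul_negr.
  rewrite cycE mulgA (le_trans _ x_s)//; apply: rl_lemull.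
  exact: le_trans (rl_lemulr _ ty) (rl_rdiv_mul_le _ _).
- move=> x y /genE[s [Ms s1 sx _ x_s]] /genE[t [Mt t1 ty t_y _]].
  apply: (intro _ s (s * t)) => //; first exact: MonoidClosureM.
    by apply: le_trans (leUl _ _).
  rewrite ldivP leUx -!ldivP; apply/andP; split.
    by rewrite cycE mulgA rl_mul_le1.
  by rewrite -mulgA rl_mul_le1.
- move=> x y /genE[s [Ms s1 sx s_x _]] /genE[t [Mt t1 ty _ _]].
  apply: (intro _ (s * t) s) => //; first exact: MonoidClosureM.
    rewrite lexI (le_trans (rl_mul_negr _ t1))//=.
    by rewrite (le_trans (rl_mul_negl _ s1)).
  by apply: le_trans s_x; apply: rl_lemulr; apply: leIl.
- move=> x y z /genE[s [Ms _ sx _ _]] /genE[t [Mt _ _ t_z _]] /andP[xy yz].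
  apply: (intro _ s t) => //; first exact: le_trans xy.
  exact: le_trans (rl_lemulr _ yz) t_z.
Qed.

(** * The implications between the conditions *)

Lemma prime_convsub_abs_join H a b : e_cyclic L -> prime_convex_subalgebra H ->
  H (rl_abs a `|` rl_abs b) -> H a \/ H b.
Proof.
move=> cyc [cH Hprime] Hab.
pose gen c := convsub_gen [set rl_abs c].
have gen1 c x : [set rl_abs c] x -> x <= 1 by move=> ->; apply: rl_abs_le1.
have cgen c : is_convex_subalgebra (gen c).
  exact: convsub_gen_convex_subalgebra cyc (@gen1 c).
have gen_self c : gen c c.
  apply/convsub_abs => //; apply: sub_convsub_gen => //; exact: rl_abs_le1.
suff sub : (gen a `&` gen b)%classic `<=` H.
  by case: (Hprime _ _ (cgen a) (cgen b) sub) => sub'; [left|right]; apply: sub'.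
move=> z [/(convsub_abs _ (cgen a))[s Ms /andP[sz _]]].
move=> /(convsub_abs _ (cgen b))[t Mt /andP[tz _]].
apply/convsub_abs => //.
have s1 := monoid_closure_le1 (@gen1 a) Ms.
(* The closure lemma is used twice: first [t] is reduced to [rl_abs b] with [s] fixed, then [s] to
   [rl_abs a]. *)
have Hst : H (s `|` t).
  apply: (convsub_join_monoid_closure cH s1 (@gen1 b) _ Mt) => _ ->; rewrite joinC.
  apply: (convsub_join_monoid_closure cH (rl_abs_le1 b) (@gen1 a) _ Ms) => _ ->.
  by rewrite joinC.
by apply: (convsub_up cH Hst); [rewrite leUx sz | apply: rl_abs_le1].
Qed.

Lemma total_convsub_of_ldiv H : is_convex_subalgebra H ->
  (forall a b, H (ldiv a b `&` 1) \/ H (ldiv b a `&` 1)) ->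
  total_on [set K | convex_subalgebras L K /\ H `<=` K] subset.
Proof.
move=> cH Hdiv X Y [cX HX] [cY HY].
have [|/(not_subset_convsub_neg cY cX)[a [a1 Xa nYa]]] := pselect (X `<=` Y).
  by left.
have [|/(not_subset_convsub_neg cX cY)[b [b1 Yb nXb]]] := pselect (Y `<=` X).
  by right.
exfalso.
have up K x y : is_convex_subalgebra K -> H `<=` K -> y <= 1 ->
    H (ldiv x y `&` 1) -> K x -> K y.
  move=> cK HK y1 /HK Kh Kx; apply: (convsub_up cK (convsub_mul cK Kx Kh)) => //.
  by rewrite ldivP leIl.
by case: (Hdiv a b) => h; [apply/nXb/(up _ a) | apply/nYa/(up _ b)].
Qed.

Lemma prime_of_total_convsub H : e_cyclic L -> is_convex_subalgebra H ->
  total_on [set K | convex_subalgebras L K /\ H `<=` K] subset ->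
  prime_convex_subalgebra H.
Proof.
move=> cyc cH tot; split=> // X Y cX cY XYH.
have [XH|/(not_subset_convsub_neg cH cX)[x [x1 Xx nHx]]] := pselect (X `<=` H).
  by left.
have [YH|/(not_subset_convsub_neg cH cY)[y [y1 Yy nHy]]] := pselect (Y `<=` H).
  by right.
exfalso.
have Hxy : H (x `|` y).
  apply: XYH; split; [apply: (convsub_up cX Xx)|apply: (convsub_up cY Yy)];
  by rewrite ?leUl ?leUr// leUx x1.
(* Generators must be negative, so only the negative part of [H] is taken; absolute values recover
   the rest. *)
pose G c : set L := [set z | z <= 1 /\ (z = c \/ H z)].
have G1 c z : G c z -> z <= 1 by case.
have cG c : is_convex_subalgebra (convsub_gen (G c)).
  exact: convsub_gen_convex_subalgebra cyc (@G1 c).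
have HG c : H `<=` convsub_gen (G c).
  move=> z Hz; apply/convsub_abs => //; apply: sub_convsub_gen.
    exact: rl_abs_le1.
  by split; [exact: rl_abs_le1 | right; apply/convsub_abs].
have Gc c : c <= 1 -> convsub_gen (G c) c.
  by move=> c1; apply: sub_convsub_gen => //; split=> //; left.
(* Some product [s] of generators lies below [v], so [v] equals [v]|[s], and it suffices that [v]
   joined with each generator is in [H]. *)
have absorb u v : v <= 1 -> H (v `|` u) -> convsub_gen (G u) v -> H v.
  move=> v1 Hvu [s Ms /andP[sv _]].
  rewrite -(join_l sv).
  apply: (convsub_join_monoid_closure cH v1 (@G1 u) _ Ms) => z [z1 [->//|Hz]].
  by apply: (convsub_up cH Hz); rewrite ?leUr// leUx v1.
have [sub|sub] := tot _ _ (conj (cG x) (@HG x)) (conj (cG y) (@HG y)).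
  by apply/nHx/(absorb y) => //; apply/sub/Gc.
by apply/nHy/(absorb x); rewrite 1?joinC//; apply/sub/Gc.
Qed.

End ResiduatedLatticeTheory.

Theorem lemma4p2 (d : Order.disp_t) (L : residuatedLatticeType d)
    (Lcyc : e_cyclic L) (Lprelin : left_prelinear L)
    (H : set L) (Hconv : convex_subalgebras L H) :
  [<-> prime_convex_subalgebra H;
       forall a b : L, H (rl_abs a `|` rl_abs b) -> H a \/ H b;
       forall a b : L, rl_abs a `|` rl_abs b = 1 -> H a \/ H b;
       forall a b : L, H (ldiv a b `&` 1) \/ H (ldiv b a `&` 1);
       total_on [set K | convex_subalgebras L K /\ H `<=` K] subset].
Proof.
tfae.
- by move=> Hprime a b; apply: prime_convsub_abs_join.
- by move=> Habs a b ab1; apply: Habs; rewrite ab1; apply: convsub_one.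
- by move=> H1 a b; apply: H1; rewrite !rl_abs_neg ?leIr.
- exact: total_convsub_of_ldiv.
- exact: prime_of_total_convsub.
Qed.
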